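(* Let $\mathbb{F}_q$ be a finite field of characteristic $p$, $a,b\in\mathbb{F}_q$ with $b\neq0$, and $Q=\begin{pmatrix} a & b\\ 1 & 0\end{pmatrix}$. Suppose the characteristic polynomial $x^2-ax-b$ has a repeated root $\gamma\in\mathbb{F}_q$, and let $l$ be the multiplicative order of $\gamma$. Then the non-trivial orbits of $G=\langle Q\rangle$ acting on $\mathbb{F}_q\times\mathbb{F}_q$ have lengths $l$ and $pl$.
   Context: $G=\langle Q\rangle$ acts on $\mathbb{F}_q\times\mathbb{F}_q$ (column vectors) by $v\mapsto Q^nv$; orbit length is the number of elements of the orbit; non-trivial orbits are orbits of non-zero vectors. *)

(* Defs.v *)
From mathcomp Require Import all_boot all_order all_algebra all_fingroup.

Set Implicit Arguments.
Unset Strict Implicit.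
Unset Printing Implicit Defensive.

Import GroupScope GRing.Theory.
Local Open Scope ring_scope.

Section Orbits.
Variable F : finFieldType.

Definition Qmx (a b : F) : 'M[F]_2 :=
  \matrix_(i < 2, j < 2)
    if i == 0 then (if j == 0 then a else b) else (if j == 0 then 1 else 0).

Lemma char_poly_Qmx a b : char_poly (Qmx a b) = 'X^2 - a *: 'X - b%:P.
Proof.
rewrite /char_poly (expand_det_row _ 0) !big_ord_recl big_ord0 addr0.
rewrite /cofactor !det_mx11 !mxE /= expr0 expr1 !mulr1n !mulr0n.
by rewrite !mul1r !sub0r subr0 mulN1r opprK mulr1 mulrBl -expr2 mul_polyC.
Qed.

Lemma Qmx_unit a b : b != 0 -> Qmx a b \is a GRing.unit.
Proof.
move=> b0; change (Qmx a b \in unitmx).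
rewrite unitmxE (expand_det_row _ 0) !big_ord_recl big_ord0 addr0.
rewrite /cofactor !det_mx11 !mxE /= expr0 expr1 mulr0 mulr0 add0r.
by rewrite mulr1 mulrN1 unitrN unitfE.
Qed.

Definition QGL (a b : F) (hb : b != 0) : {'GL_2[F]} :=
  FinRing.unit _ (Qmx_unit a hb).

Definition mulcV (v : 'cV[F]_2) (g : {'GL_2[F]}) : 'cV[F]_2 := GLval g *m v.

(* Library actions are right actions, whereas g |-> g *m v is a left action.  *)
(* On the commutative group <[g]> the two notions agree, so <[g]> is taken as *)
(* the domain of the action.                                                  *)
Lemma mulcV_is_action (g : {'GL_2[F]}) : is_action <[g]> mulcV.
Proof.
split=> [x u v /(congr1 (mulmx (invmx (GLval x))))|v x y gx gy].
  by rewrite !mulKmx ?GL_unitmx //; exact: (valP x).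
rewrite /mulcV mulmxA; congr (_ *m v).
have -> : (x * y = y * x)%g by exact: (centsP (cycle_abelian g)).
by [].
Qed.

Definition cycle_action (g : {'GL_2[F]}) : action <[g]> 'cV[F]_2 :=
  Action (mulcV_is_action g).

Lemma mem_orbit_Qmx a b (hb : b != 0) (v w : 'cV[F]_2) :
  w \in orbit (cycle_action (QGL a hb)) <[QGL a hb]> v
  <-> exists n : int, w = (Qmx a b) ^ n *m v.
Proof.
have XE n : GLval (QGL a hb ^+ n)%g = Qmx a b ^+ n.
  by rewrite FinRing.val_unitX.
split=> [/orbitP[g /cycleP[n ->] <-]|[[n|n] ->]].
- by exists (Posz n); rewrite /= /mulcV XE.
- by apply/orbitP; exists (QGL a hb ^+ n)%g; rewrite ?mem_cycle //= /mulcV XE.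
apply/orbitP; exists (QGL a hb ^- n.+1)%g; first by rewrite groupV mem_cycle.
by rewrite /= /mulcV GL_VE XE.
Qed.

End Orbits.

(* Main.v *)
Require Import Defs.
From mathcomp Require Import all_boot all_order all_algebra all_fingroup.
From mathcomp Require Import cyclic.

Import GroupScope GRing.Theory.
Local Open Scope ring_scope.

(** With a double root gamma, Cayley-Hamilton gives Q = gamma + N with
    N ^ 2 = 0, so Q ^ n v = gamma ^ n v + n gamma ^ (n - 1) N v. If N v = 0 then
    Q ^ n fixes v iff l divides n. Otherwise applying N to Q ^ n v = v gives
    gamma ^ n = 1, whence also n = 0 in F: Q ^ n fixes v iff both l and p divide
    n, i.e. iff p l divides n, since l is prime to p. Both cases occur, as N is
    singular and nonzero. *)

(** The stabilizer of [v] is generated by [x ^+ d], and this subgroup has index [d] in the cyclic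
    group. *)
Lemma card_orbit_cycle (aT : finGroupType) (rT : finType) (x : aT)
    (to : action <[x]> rT) (v : rT) (d : nat) :
  (forall n, (to v (x ^+ n)%g == v) = (d %| n)%N) ->
  #|orbit to <[x]> v| = d.
Proof.
move=> fixP.
(* The power [x ^+ #[x]] is the identity, so it fixes [v]; positivity of [d] follows, as 0 divides
   no positive number. *)
have d_dvd : (d %| #[x]%g)%N by rewrite -fixP expg_order act1.
have d_gt0 : (0 < d)%N by apply: dvdn_gt0 d_dvd; exact: order_gt0.
have stabE : 'C_(<[x]>)[v | to]%g = <[x ^+ d]>%g.
  apply/setP=> y; apply/setIP/cycleP => [[/cycleP[n ->]]|[k ->]].
    case/setIP=> _; rewrite inE sub1set inE fixP => /dvdnP[k ->].
    by exists k; rewrite mulnC expgM.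
  rewrite -expgM; split; first exact: mem_cycle.
  by rewrite !inE mem_cycle sub1set inE fixP dvdn_mulr.
rewrite card_orbit_in ?subxx // stabE -divgS; last by rewrite cycle_subG mem_cycle.
by rewrite -!orderE orderXdiv // divnA // mulKn.
Qed.

Section NilpotentPerturbation.
Variables (F : fieldType) (m : nat) (c : F) (N : 'M[F]_m.+1).
Hypothesis N2 : N *m N = 0.

(** The binomial expansion stops after its linear term. At [n = 0] the truncated exponent [n.-1] is
    harmless, since that term has coefficient 0. *)
Lemma expr_scalarD_nilp_mul n (v : 'cV_m.+1) :
  (c%:M + N) ^+ n *m v = c ^+ n *: v + (c ^+ n.-1 *+ n) *: (N *m v).
Proof.
elim: n => [|n IHn]; first by rewrite !expr0 mul1mx scale1r scale0r addr0.
rewrite exprS -mulmxE -mulmxA IHn mulmxDl mul_scalar_mx mulmxDr -!scalemxAr.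
rewrite mulmxA N2 mul0mx scaler0 addr0 scalerDr !scalerA -exprS -addrA.
congr (_ + _); rewrite -scalerDl mulrS addrC; congr ((_ + _) *: _).
by case: n {IHn} => [|n]; rewrite ?mulr0 // mulrnAr -exprS.
Qed.

Lemma scalarD_nilp_fix_ker n (v : 'cV_m.+1) : v != 0 -> N *m v = 0 ->
  ((c%:M + N) ^+ n *m v == v) = (c ^+ n == 1).
Proof.
move=> v0 Nv; rewrite expr_scalarD_nilp_mul Nv scaler0 addr0.
rewrite -subr_eq0 -{2}[v]scale1r -scalerBl scaler_eq0 (negPf v0) orbF.
by rewrite subr_eq0.
Qed.

Lemma scalarD_nilp_fix_nker n (v : 'cV_m.+1) : N *m v != 0 ->
  ((c%:M + N) ^+ n *m v == v) = (c ^+ n == 1) && (n%:R == 0 :> F).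
Proof.
move=> Nv; rewrite expr_scalarD_nilp_mul; apply/eqP/andP => [Ev|[/eqP cn /eqP n0]].
  have cn : c ^+ n = 1.
    (* Multiplying by [N] kills the linear term and leaves [c ^+ n *: (N *m v) = N *m v]. *)
    have := congr1 (mulmx N) Ev.
    rewrite mulmxDr -!scalemxAr mulmxA N2 mul0mx scaler0 addr0 => /eqP.
    rewrite -subr_eq0 -{2}[N *m v]scale1r -scalerBl scaler_eq0 (negPf Nv) orbF.
    by rewrite subr_eq0 => /eqP.
  split; first by rewrite cn.
  move/eqP: Ev; rewrite cn scale1r -subr_eq0 addrAC subrr add0r scaler_eq0.
  rewrite (negPf Nv) orbF -mulr_natr mulf_eq0 => /orP[cn0|//].
  (* The factor [c ^+ n.-1] cannot vanish: it is 1 for [n = 0], and otherwise it divides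
     [c ^+ n = 1]. *)
  case: n cn cn0 => [|n] cn; first by rewrite oner_eq0.
  by move/eqP=> cn0; move/eqP: cn; rewrite exprS cn0 mulr0 eq_sym oner_eq0.
by rewrite cn scale1r -mulr_natr n0 mulr0 scale0r addr0.
Qed.

End NilpotentPerturbation.

(** The Frobenius map is injective, so no element has multiplicative order divisible by the
    characteristic. *)
Lemma prim_root_coprime_pchar (F : fieldType) (p l : nat) (c : F) :
  p \in [pchar F] -> l.-primitive_root c -> coprime p l.
Proof.
move=> pF cl; rewrite prime_coprime ?(pcharf_prime pF) //;
by apply/negP=> /(prim_root_pcharF cl); rewrite pF.
Qed.

(** The square of ['X - c%:P] divides the characteristic polynomial; both are monic of degree 2. *)
Lemma char_poly_double_root (F : fieldType) (A : 'M[F]_2) (c : F) :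
  (1 < mup c (char_poly A))%N -> char_poly A = ('X - c%:P) ^+ 2.
Proof.
have A_monic := char_poly_monic A.
rewrite mup_geq ?monic_neq0 // => dvd_c; apply/eqP; rewrite eq_sym.
rewrite -eqp_monic ?monic_exp ?monicXsubC //.
by rewrite -dvdp_size_eqp // size_exp_XsubC size_char_poly.
Qed.

Lemma double_root_nilp (F : fieldType) (A : 'M[F]_2) (c : F) :
  (1 < mup c (char_poly A))%N -> (A - c%:M) *m (A - c%:M) = 0.
Proof.
move=> /char_poly_double_root charA; rewrite mulmxE -expr2.
have := Cayley_Hamilton A; rewrite charA rmorphXn rmorphB /=.
by rewrite horner_mx_X horner_mx_C.
Qed.

Theorem mainTheorem13 (F : finFieldType) (p : nat) (hp : p \in [pchar F])
    (a b : F) (hb : b != 0) (gamma : F)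
    (hgamma : (2 <= mup gamma (char_poly (Qmx a b)))%N)
    (l : nat) (hl : l.-primitive_root gamma) :
  forall n : nat,
    (exists2 v : 'cV[F]_2, v != 0 &
       #|orbit (cycle_action (QGL a hb)) <[QGL a hb]> v| = n)
    <-> n = l \/ n = (p * l)%N.
Proof.
set N := Qmx a b - gamma%:M.
have N2 : N *m N = 0 by exact: double_root_nilp hgamma.
have QE n v : cycle_action (QGL a hb) v (QGL a hb ^+ n)%g
            = (gamma%:M + N) ^+ n *m v.
  by rewrite /= /mulcV FinRing.val_unitX addrC subrK.
have orbit_ker v : v != 0 -> N *m v = 0 ->
    #|orbit (cycle_action (QGL a hb)) <[QGL a hb]> v| = l.
  move=> v0 Nv; apply: card_orbit_cycle => n.
  by rewrite QE scalarD_nilp_fix_ker // (prim_order_dvd hl).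
have orbit_nker v : N *m v != 0 ->
    #|orbit (cycle_action (QGL a hb)) <[QGL a hb]> v| = (p * l)%N.
  move=> Nv; apply: card_orbit_cycle => n.
  rewrite QE scalarD_nilp_fix_nker // -(prim_order_dvd hl) -(dvdn_pcharf hp).
  by rewrite andbC Gauss_dvd // (@prim_root_coprime_pchar F p l gamma).
(* Subtracting a scalar matrix keeps the lower-left entry 1 of [Qmx a b], so [N] does not kill the
   first basis vector. *)
have Ne : N *m delta_mx 0 0 != 0 :> 'cV_2.
  apply/eqP=> /matrixP /(_ 1 0) /eqP.
  by rewrite -colE !mxE /= mulr0n subr0 oner_eq0.
move=> n; split=> [[v v0 <-]|].
  have [Nv|Nv] := eqVneq (N *m v) 0; first by left; exact: orbit_ker.
  by right; exact: orbit_nker.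
case=> ->.
  (* The image of the first basis vector lies in the kernel of [N] and gives length [l]; the basis
     vector itself gives [p * l]. *)
  exists (N *m delta_mx 0 0) => //.
  by apply: orbit_ker => //; rewrite mulmxA N2 mul0mx.
exists (delta_mx 0 0); last exact: orbit_nker.
by apply: contraNneq Ne => ->; rewrite mulmx0.
Qed.
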